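(* Let $u_2=\phi(u,u_1)$ be an autonomous second-order ODE, with $\phi$ smooth on an open set $U\subseteq J^1(\mathbb R,\mathbb R)$, let $(M,g)$ be its associated 3-dimensional Riemannian manifold, and let $\Sigma_C$ be a leaf of the energy foliation of the ODE, endowed with the Riemannian metric induced by $g$. Then the intrinsic Gauss curvature of $\Sigma_C$ is $$K_{\mathrm{int}}=-\frac{e_1(\phi)}{u_1},$$ where $e_1=\partial_x+u_1\partial_u+\phi\,\partial_{u_1}$ (and the right-hand side is restricted to $\Sigma_C$).
   Context: $J^1(\mathbb R,\mathbb R)$ is the first-order jet bundle, identified with $\mathbb R^3$ with standard coordinates $(x,u,u_1)$. The function $\phi$ is smooth on an open subset $U\subseteq J^1(\mathbb R,\mathbb R)$ and depends only on $(u,u_1)$. The notation $e_1(\phi)$ means the derivative of $\phi$ along the vector field $e_1$. The 3-dimensional Riemannian manifold associated with the ODE $u_2=\phi(u,u_1)$ is $M=\{(x,u,u_1)\in U: u_1\neq 0\}$ with the Riemannian metric $$g=(1 + u_1^2)\, dx^2 - 2 u_1\, dx\, du + \left( 1 + \frac{\phi^2}{u_1^2} \right) du^2 - 2 \frac{\phi}{u_1}\, du\, du_1 + du_1^2 .$$ It has the orthonormal frame $e_1=\partial_x+u_1\partial_u+\phi\,\partial_{u_1}$, $e_2=\partial_u+\frac{\phi}{u_1}\partial_{u_1}$, $e_3=\partial_{u_1}$, with dual coframe $\omega^1=dx$, $\omega^2=-u_1\,dx+du$, $\omega^3=-\frac{\phi}{u_1}\,du+du_1$. The energy foliation $\mathcal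 E$ of the ODE is the foliation of $M$ by surfaces tangent to the involutive distribution $D_p=\{v\in T_pM:\omega^3_p(v)=0\}=\mathrm{span}\{e_1,e_2\}_p$. Its leaves are given locally by level sets $\Sigma_C=\{p: E(p)=C\}$, $C\in\mathbb R$, of a smooth function $E$ satisfying $dE=\mu\,\omega^3$ with $\mu$ a non-vanishing smooth function. The intrinsic Gauss curvature of $\Sigma_C$ is the Gaussian curvature of the induced metric $\tilde g=\tilde\omega^1\otimes\tilde\omega^1+\tilde\omega^2\otimes\tilde\omega^2$, where $\tilde\omega^i$ is the restriction of $\omega^i$ to $\Sigma_C$. *)

(* Defs.v *)
From Stdlib Require Import Reals List.
From Coquelicot Require Import Coquelicot.
Open Scope R_scope.

(** * Calculus in Euclidean spaces *)

Definition dir_deriv {V : NormedModule R_AbsRing} (v : V) (f : V -> R) (p : V) : R :=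
  Derive (fun h : R => f (plus p (scal h v))) 0.

Fixpoint iter_deriv {V : NormedModule R_AbsRing} (l : list V) (f : V -> R) : V -> R :=
  match l with
  | nil => f
  | v :: l' => dir_deriv v (iter_deriv l' f)
  end.

(** C^infinity on the set [W] (meant for open [W]): all iterated directional
    derivatives exist and are continuous at the points of [W].  [Derive] is
    total, so existence is required explicitly. *)
Definition smooth_on {V : NormedModule R_AbsRing} (W : V -> Prop) (f : V -> R) : Prop :=
  forall (l : list V) (p : V), W p ->
    continuous (iter_deriv l f) p /\
    forall v : V, ex_derive (fun h : R => iter_deriv l f (plus p (scal h v))) 0.

(** * The jet space J^1(R,R) = R^3, with coordinates (x, u, u_1) *)

Notation plane := (R * R)%type.
Notation J1 := (R * R * R)%type.

(** These also serve as the coordinate 1-forms dx, du, du_1, since tangent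
    vectors of [J1] are triples. *)
Definition cx (p : J1) : R := fst (fst p).
Definition cu (p : J1) : R := snd (fst p).
Definition cu1 (p : J1) : R := snd p.

(** * The Riemannian manifold (M, g) of the ODE u_2 = phi(u, u_1) *)

Definition depends_on_u_u1 (U : J1 -> Prop) (phi : J1 -> R) : Prop :=
  forall p q : J1, U p -> U q -> cu p = cu q -> cu1 p = cu1 q -> phi p = phi q.

Definition ode_manifold (U : J1 -> Prop) (p : J1) : Prop := U p /\ cu1 p <> 0.

(** A product of differentials such as dx du in the formula for g is the
    symmetric product (dx (x) du + du (x) dx) / 2. *)
Definition ode_metric (phi : J1 -> R) (p : J1) (v w : J1) : R :=
  (1 + cu1 p ^ 2) * (cx v * cx w)
  - cu1 p * (cx v * cu w + cu v * cx w)
  + (1 + phi p ^ 2 / cu1 p ^ 2) * (cu v * cu w)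
  - phi p / cu1 p * (cu v * cu1 w + cu1 v * cu w)
  + cu1 v * cu1 w.

Definition e1 (phi : J1 -> R) (p : J1) : J1 := (1, cu1 p, phi p).

Definition omega3 (phi : J1 -> R) (p : J1) (v : J1) : R :=
  - (phi p / cu1 p) * cu v + cu1 v.

(** Derivative of [f] along the vector field [X]. *)
Definition lie_deriv (X : J1 -> J1) (f : J1 -> R) (p : J1) : R :=
  dir_deriv (X p) f p.

(** * Regular surfaces in R^3 *)

Inductive idx : Set := i1 | i2.

Definition basis (i : idx) : plane :=
  match i with i1 => (1, 0) | i2 => (0, 1) end.

Definition sum_idx (F : idx -> R) : R := F i1 + F i2.

Definition pd (i : idx) (f : plane -> R) : plane -> R := dir_deriv (basis i) f.

Definition coord_vector (psi : plane -> J1) (i : idx) (q : plane) : J1 :=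
  (pd i (fun r => cx (psi r)) q,
   pd i (fun r => cu (psi r)) q,
   pd i (fun r => cu1 (psi r)) q).

Definition tangent_comb (psi : plane -> J1) (q : plane) (a b : R) : J1 :=
  plus (scal a (coord_vector psi i1 q)) (scal b (coord_vector psi i2 q)).

(** Local parametrization of [S]: a smooth injective immersion of an open subset
    [V] of the plane that is a homeomorphism onto a relatively open subset of [S].
    The last clause says that [psi] maps [V] into [S] and is open as a map to [S]. *)
Definition parametrization (S : J1 -> Prop) (V : plane -> Prop) (psi : plane -> J1) : Prop :=
  open V /\
  (smooth_on V (fun q => cx (psi q)) /\
   smooth_on V (fun q => cu (psi q)) /\
   smooth_on V (fun q => cu1 (psi q))) /\
  (forall q, V q -> forall a b : R,
     tangent_comb psi q a b = zero -> a = 0 /\ b = 0) /\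
  (forall q r, V q -> V r -> psi q = psi r -> q = r) /\
  (forall V' : plane -> Prop, open V' -> (forall q, V' q -> V q) ->
     exists W : J1 -> Prop, open W /\
       forall p, S p /\ W p <-> exists q, V' q /\ psi q = p).

Definition regular_surface (S : J1 -> Prop) : Prop :=
  forall p, S p -> exists V psi q, parametrization S V psi /\ V q /\ psi q = p.

Definition tangent_vector (S : J1 -> Prop) (p v : J1) : Prop :=
  exists V psi q a b,
    parametrization S V psi /\ V q /\ psi q = p /\ v = tangent_comb psi q a b.

(** Connectedness in the subspace topology. *)
Definition connected_set (S : J1 -> Prop) : Prop :=
  forall A B : J1 -> Prop, open A -> open B ->
    (forall p, S p -> A p \/ B p) ->
    (exists p, S p /\ A p) -> (exists p, S p /\ B p) ->
    exists p, S p /\ A p /\ B p.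

(** * The energy foliation *)

Definition connected_integral_surface (U : J1 -> Prop) (phi : J1 -> R) (S : J1 -> Prop) : Prop :=
  (exists p, S p) /\
  (forall p, S p -> ode_manifold U p) /\
  regular_surface S /\
  (forall p v, S p -> (tangent_vector S p v <-> omega3 phi p v = 0)) /\
  connected_set S.

(** Leaves are the maximal connected integral surfaces of D = ker omega^3.
    Nothing is lost by considering only surfaces embedded in R^3: D contains
    d/dx and projects onto the u-direction, so each integral surface is locally
    a cylinder, in the x-direction, over the graph of a solution of
    d(u_1)/du = phi/u_1, and a leaf lies over a single such graph. *)
Definition energy_leaf (U : J1 -> Prop) (phi : J1 -> R) (S : J1 -> Prop) : Prop :=
  connected_integral_surface U phi S /\
  forall S' : J1 -> Prop, connected_integral_surface U phi S' ->
    (forall p, S p -> S' p) -> forall p, S' p -> S p.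

(** * Gauss curvature *)

(** A metric on a plane domain is given by its coefficients [h i j q]. *)
Definition metric_det (h : idx -> idx -> plane -> R) (q : plane) : R :=
  h i1 i1 q * h i2 i2 q - h i1 i2 q * h i2 i1 q.

Definition metric_inv (h : idx -> idx -> plane -> R) (i j : idx) (q : plane) : R :=
  match i, j with
  | i1, i1 => h i2 i2 q / metric_det h q
  | i1, i2 => - h i1 i2 q / metric_det h q
  | i2, i1 => - h i2 i1 q / metric_det h q
  | i2, i2 => h i1 i1 q / metric_det h q
  end.

(** Gamma^k_{ij} of the Levi-Civita connection. *)
Definition christoffel (h : idx -> idx -> plane -> R) (k i j : idx) (q : plane) : R :=
  sum_idx (fun l => / 2 * metric_inv h k l q *
    (pd i (h j l) q + pd j (h i l) q - pd l (h i j) q)).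

(** [riemann h m i j k] is the [m]-th component of R(d_i, d_j) d_k, where
    R(X,Y)Z = nabla_X nabla_Y Z - nabla_Y nabla_X Z - nabla_[X,Y] Z. *)
Definition riemann (h : idx -> idx -> plane -> R) (m i j k : idx) (q : plane) : R :=
  pd i (christoffel h m j k) q - pd j (christoffel h m i k) q
  + sum_idx (fun n => christoffel h n j k q * christoffel h m i n q
                      - christoffel h n i k q * christoffel h m j n q).

(** <R(d_1, d_2) d_2, d_1> / det h. *)
Definition gauss_curvature (h : idx -> idx -> plane -> R) (q : plane) : R :=
  sum_idx (fun m => h m i1 q * riemann h m i1 i2 i2 q) / metric_det h q.

Definition induced_metric (g : J1 -> J1 -> J1 -> R) (psi : plane -> J1)
    (i j : idx) (q : plane) : R :=
  g (psi q) (coord_vector psi i q) (coord_vector psi j q).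

(** [S], with the metric induced by [g], has Gauss curvature [K] at [p]: the
    value computed in any local parametrization around [p] is [K], and there is
    such a parametrization. *)
Definition has_gauss_curvature (g : J1 -> J1 -> J1 -> R) (S : J1 -> Prop) (p : J1) (K : R) : Prop :=
  (exists V psi q, parametrization S V psi /\ V q /\ psi q = p) /\
  forall V psi q, parametrization S V psi -> V q -> psi q = p ->
    gauss_curvature (induced_metric g psi) q = K.

(* Main.v *)
(** On an integral surface of ker omega^3, with local coordinates in which
    x, u, v = u_1 are functions, dv = F du with F = phi / v, and the induced metric
    is dx^2 + beta^2 with beta = du - v dx.  Then d(dx) = 0 and
    d beta = F dx /\ beta, so the Levi-Civita connection form of the orthonormal
    coframe (dx, beta) is F beta.  Since phi depends only on (u, u_1), we have
    d(phi) = (e_1(phi) / v) du, whence d(F beta) = (e_1(phi) / v) dx /\ beta, and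
    the curvature is minus this coefficient. *)

Require Import Defs.
From Stdlib Require Import Reals List Lra.
From Coquelicot Require Import Coquelicot.
Open Scope R_scope.

(** * Partial derivatives on open sets of the plane *)

Definition has_pd (i : idx) (f : plane -> R) (q : plane) (l : R) : Prop :=
  is_derive (fun t : R => f (plus q (scal t (basis i)))) 0 l.

Definition ex_pd (i : idx) (f : plane -> R) (q : plane) : Prop :=
  ex_derive (fun t : R => f (plus q (scal t (basis i)))) 0.

Lemma ex_pd_correct i f q : ex_pd i f q -> has_pd i f q (pd i f q).
Proof. intro H. apply Derive_correct, H. Qed.

Lemma has_pd_ex i f q l : has_pd i f q l -> ex_pd i f q.
Proof. intro H. exists l. exact H. Qed.

Lemma pd_unique i f q l : has_pd i f q l -> pd i f q = l.
Proof. intro H. apply is_derive_unique, H. Qed.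

Lemma shift_0 {W : NormedModule R_AbsRing} (q v : W) : plus q (scal 0 v) = q.
Proof. rewrite (scal_zero_l v : scal 0 v = zero). apply plus_zero_r. Qed.

Lemma locally_line {W : NormedModule R_AbsRing} (P : W -> Prop) (q v : W) :
  open P -> P q -> locally (0 : R) (fun t : R => P (plus q (scal t v))).
Proof.
  intros HP Hq.
  assert (Hc : continuous (fun t : R => plus q (scal t v)) (0 : R)).
  { apply @continuous_plus; [apply continuous_const|].
    apply @continuous_scal; [apply continuous_id|apply continuous_const]. }
  apply (Hc P). rewrite shift_0. apply HP, Hq.
Qed.

Lemma has_pd_ext (V : plane -> Prop) i f g q l :
  open V -> V q -> (forall r, V r -> f r = g r) -> has_pd i f q l -> has_pd i g q l.
Proof.
  intros HV Hq E. apply is_derive_ext_loc.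
  generalize (locally_line V q (basis i) HV Hq). apply filter_imp. auto.
Qed.

Lemma has_pd_eq i f q l l' : has_pd i f q l -> l = l' -> has_pd i f q l'.
Proof. now intros H <-. Qed.

Lemma has_pd_plus i f g q l m :
  has_pd i f q l -> has_pd i g q m -> has_pd i (fun r => f r + g r) q (l + m).
Proof. intros Hf Hg. exact (is_derive_plus _ _ _ _ _ Hf Hg). Qed.

Lemma has_pd_opp i f q l : has_pd i f q l -> has_pd i (fun r => - f r) q (- l).
Proof. intros Hf. exact (is_derive_opp _ _ _ Hf). Qed.

Lemma has_pd_minus i f g q l m :
  has_pd i f q l -> has_pd i g q m -> has_pd i (fun r => f r - g r) q (l - m).
Proof. intros Hf Hg. exact (is_derive_minus _ _ _ _ _ Hf Hg). Qed.

Lemma base_point i (f : plane -> R) (q : plane) : f (plus q (scal 0 (basis i))) = f q.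
Proof. f_equal. exact (shift_0 q (basis i)). Qed.

Lemma has_pd_mult i f g q l m :
  has_pd i f q l -> has_pd i g q m ->
  has_pd i (fun r => f r * g r) q (l * g q + f q * m).
Proof.
  intros Hf Hg. generalize (is_derive_mult _ _ _ _ _ Hf Hg Rmult_comm).
  cbv beta. rewrite !(base_point i). exact (fun H => H).
Qed.

Lemma has_pd_div i f g q l m :
  has_pd i f q l -> has_pd i g q m -> g q <> 0 ->
  has_pd i (fun r => f r / g r) q ((l * g q - f q * m) / g q ^ 2).
Proof.
  intros Hf Hg H0.
  assert (H := is_derive_div _ _ _ _ _ Hf Hg). cbv beta in H.
  rewrite !(base_point i) in H. exact (H H0).
Qed.

(** * Curvature of a plane metric from an orthonormal coframe and its connection form *)

Section Coframe.

Variables (V : plane -> Prop) (h : idx -> idx -> plane -> R) (a b c : idx -> plane -> R).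
Hypothesis V_open : open V.
Hypothesis metric_coframe :
  forall i j q, V q -> h i j q = a i q * a j q + b i q * b j q.

(** The value of a /\ b on the two coordinate vectors. *)
Definition coframe_det (q : plane) : R := a i1 q * b i2 q - a i2 q * b i1 q.

Hypothesis det_neq : forall q, V q -> coframe_det q <> 0.
Hypothesis a_pd : forall i j q, V q -> ex_pd i (a j) q.
Hypothesis b_pd : forall i j q, V q -> ex_pd i (b j) q.
Hypothesis c_pd : forall i j q, V q -> ex_pd i (c j) q.
Hypothesis a_pd2 : forall i j k q, V q -> ex_pd i (pd j (a k)) q.
Hypothesis b_pd2 : forall i j k q, V q -> ex_pd i (pd j (b k)) q.
(** Cartan's first structure equations da = c /\ b and db = - c /\ a, evaluated on (d_1, d_2); they
    make [c] the Levi-Civita connection form of the coframe. *)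
Hypothesis a_structure : forall q, V q ->
  pd i1 (a i2) q - pd i2 (a i1) q = c i1 q * b i2 q - c i2 q * b i1 q.
Hypothesis b_structure : forall q, V q ->
  pd i1 (b i2) q - pd i2 (b i1) q = c i2 q * a i1 q - c i1 q * a i2 q.
Hypothesis a_schwarz : forall q, V q -> pd i1 (pd i2 (a i2)) q = pd i2 (pd i1 (a i2)) q.
Hypothesis b_schwarz : forall q, V q -> pd i1 (pd i2 (b i2)) q = pd i2 (pd i1 (b i2)) q.

Lemma pd_metric i j k q : V q ->
  pd i (h j k) q = pd i (a j) q * a k q + a j q * pd i (a k) q
                 + (pd i (b j) q * b k q + b j q * pd i (b k) q).
Proof.
  intro Hq. apply pd_unique.
  apply has_pd_ext with V (fun r => a j r * a k r + b j r * b k r); auto.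
  - intros r Hr. symmetry. auto.
  - apply has_pd_plus; apply has_pd_mult; apply ex_pd_correct; auto.
Qed.

Lemma metric_det_coframe q : V q -> metric_det h q = coframe_det q * coframe_det q.
Proof.
  intro Hq. unfold metric_det, coframe_det. rewrite !metric_coframe by assumption. ring.
Qed.

(* The contractions [a_k Gamma^k_ij] and [b_k Gamma^k_ij], as dictated by the connection
   equations [nabla a = c b] and [nabla b = - c a]. *)
Definition nabla_a (i j : idx) (q : plane) : R := pd i (a j) q - c i q * b j q.
Definition nabla_b (i j : idx) (q : plane) : R := pd i (b j) q + c i q * a j q.

(* The frame dual to the coframe, multiplied by [coframe_det]. *)
Definition dual_a (k : idx) (q : plane) : R :=
  match k with i1 => b i2 q | i2 => - b i1 q end.
Definition dual_b (k : idx) (q : plane) : R :=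
  match k with i1 => - a i2 q | i2 => a i1 q end.

(** The covariant derivatives of the coframe determine the connection: the dual frame recovers each
    symbol from its contractions with [a] and [b]. *)
Lemma christoffel_coframe k i j q : V q ->
  christoffel h k i j q =
  (dual_a k q * nabla_a i j q + dual_b k q * nabla_b i j q) / coframe_det q.
Proof.
  intro Hq.
  assert (D0 := det_neq q Hq). assert (Sa := a_structure q Hq). assert (Sb := b_structure q Hq).
  (* Once the structure equations are solved for [pd i1 (a i2)] and [pd i1 (b i2)], each component
     is a rational identity in the remaining quantities. *)
  assert (Sa' : pd i1 (a i2) q = pd i2 (a i1) q + (c i1 q * b i2 q - c i2 q * b i1 q)) by lra.
  assert (Sb' : pd i1 (b i2) q = pd i2 (b i1) q + (c i2 q * a i1 q - c i1 q * a i2 q)) by lra.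
  unfold christoffel, sum_idx, metric_inv.
  rewrite !pd_metric by assumption.
  destruct k, i, j; rewrite !metric_det_coframe, !metric_coframe by assumption;
  unfold nabla_a, nabla_b, dual_a, dual_b; rewrite ?Sa', ?Sb';
  unfold coframe_det in *; field; exact D0.
Qed.

Lemma christoffel_ex_pd l k i j q : V q -> ex_pd l (christoffel h k i j) q.
Proof.
  intro Hq. eapply has_pd_ex.
  apply has_pd_ext with V
    (fun r => (dual_a k r * nabla_a i j r + dual_b k r * nabla_b i j r) / coframe_det r);
    auto.
  { intros r Hr. symmetry. apply christoffel_coframe, Hr. }
  assert (A : forall m n, has_pd m (a n) q (pd m (a n) q)) by (intros; apply ex_pd_correct; auto).
  assert (B : forall m n, has_pd m (b n) q (pd m (b n) q)) by (intros; apply ex_pd_correct; auto).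
  assert (C : forall m n, has_pd m (c n) q (pd m (c n) q)) by (intros; apply ex_pd_correct; auto).
  apply has_pd_div; [| |auto].
  - apply has_pd_plus; apply has_pd_mult.
    (* The derivative of [dual_a k] has to be given uniformly in [k] before the case split. *)
    + instantiate (1 := match k with i1 => pd l (b i2) q | i2 => - pd l (b i1) q end).
      destruct k; [apply B|apply has_pd_opp, B].
    + apply has_pd_minus; [apply ex_pd_correct; auto|apply has_pd_mult; auto].
    + instantiate (1 := match k with i1 => - pd l (a i2) q | i2 => pd l (a i1) q end).
      destruct k; [apply has_pd_opp, A|apply A].
    + apply has_pd_plus; [apply ex_pd_correct; auto|apply has_pd_mult; auto].
  - apply has_pd_minus; apply has_pd_mult; auto.
Qed.

Lemma christoffel_a i j q : V q ->
  a i1 q * christoffel h i1 i j q + a i2 q * christoffel h i2 i j q = nabla_a i j q.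
Proof.
  intro Hq. rewrite !christoffel_coframe by assumption.
  assert (D0 := det_neq q Hq). unfold dual_a, dual_b, coframe_det in *. field. exact D0.
Qed.

Lemma christoffel_b i j q : V q ->
  b i1 q * christoffel h i1 i j q + b i2 q * christoffel h i2 i j q = nabla_b i j q.
Proof.
  intro Hq. rewrite !christoffel_coframe by assumption.
  assert (D0 := det_neq q Hq). unfold dual_a, dual_b, coframe_det in *. field. exact D0.
Qed.

(** Differentiating the connection equation of [christoffel_a] in two ways isolates the derivatives
    of the Christoffel symbols, contracted with [a]. *)
Lemma pd_christoffel_a l i j q : V q ->
  a i1 q * pd l (christoffel h i1 i j) q + a i2 q * pd l (christoffel h i2 i j) q =
  pd l (pd i (a j)) q - (pd l (c i) q * b j q + c i q * pd l (b j) q)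
  - (pd l (a i1) q * christoffel h i1 i j q + pd l (a i2) q * christoffel h i2 i j q).
Proof.
  intro Hq.
  assert (H1 : has_pd l (nabla_a i j) q
    (pd l (pd i (a j)) q - (pd l (c i) q * b j q + c i q * pd l (b j) q))).
  { apply has_pd_minus; [|apply has_pd_mult]; apply ex_pd_correct; auto. }
  assert (H2 : has_pd l (nabla_a i j) q
    (pd l (a i1) q * christoffel h i1 i j q + a i1 q * pd l (christoffel h i1 i j) q
     + (pd l (a i2) q * christoffel h i2 i j q + a i2 q * pd l (christoffel h i2 i j) q))).
  { apply (has_pd_ext V l _ _ q _ V_open Hq (christoffel_a i j)).
    apply has_pd_plus; apply has_pd_mult; apply ex_pd_correct; auto using christoffel_ex_pd. }
  apply pd_unique in H1. apply pd_unique in H2. lra.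
Qed.

Lemma pd_christoffel_b l i j q : V q ->
  b i1 q * pd l (christoffel h i1 i j) q + b i2 q * pd l (christoffel h i2 i j) q =
  pd l (pd i (b j)) q + (pd l (c i) q * a j q + c i q * pd l (a j) q)
  - (pd l (b i1) q * christoffel h i1 i j q + pd l (b i2) q * christoffel h i2 i j q).
Proof.
  intro Hq.
  assert (H1 : has_pd l (nabla_b i j) q
    (pd l (pd i (b j)) q + (pd l (c i) q * a j q + c i q * pd l (a j) q))).
  { apply has_pd_plus; [|apply has_pd_mult]; apply ex_pd_correct; auto. }
  assert (H2 : has_pd l (nabla_b i j) q
    (pd l (b i1) q * christoffel h i1 i j q + b i1 q * pd l (christoffel h i1 i j) q
     + (pd l (b i2) q * christoffel h i2 i j q + b i2 q * pd l (christoffel h i2 i j) q))).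
  { apply (has_pd_ext V l _ _ q _ V_open Hq (christoffel_b i j)).
    apply has_pd_plus; apply has_pd_mult; apply ex_pd_correct; auto using christoffel_ex_pd. }
  apply pd_unique in H1. apply pd_unique in H2. lra.
Qed.

(** The second structure equation, paired with [a]. Antisymmetrizing the differentiated connection
    equation cancels the second derivatives of [a i2] by symmetry and leaves dc. *)
Lemma riemann_a q : V q ->
  a i1 q * riemann h i1 i1 i2 i2 q + a i2 q * riemann h i2 i1 i2 i2 q =
  - (pd i1 (c i2) q - pd i2 (c i1) q) * b i2 q.
Proof.
  intro Hq.
  assert (P1 := pd_christoffel_a i1 i2 i2 q Hq).
  assert (P2 := pd_christoffel_a i2 i1 i2 q Hq).
  assert (S := a_schwarz q Hq).
  assert (A : forall i j, pd i (a j) q =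
    a i1 q * christoffel h i1 i j q + a i2 q * christoffel h i2 i j q + c i q * b j q).
  { intros i j. rewrite christoffel_a by assumption. unfold nabla_a. ring. }
  assert (B : forall i j, pd i (b j) q =
    b i1 q * christoffel h i1 i j q + b i2 q * christoffel h i2 i j q - c i q * a j q).
  { intros i j. rewrite christoffel_b by assumption. unfold nabla_b. ring. }
  (* With first derivatives expressed through the Christoffel symbols and [c], the terms in c times
     Gamma and c times c cancel in the difference; the products of two symbols are those of
     [riemann]. *)
  rewrite !A, !B in P1, P2.
  unfold riemann, sum_idx.
  lra.
Qed.

(** The sign is opposite to that in [riemann_a] because the connection matrix is skew. *)
Lemma riemann_b q : V q ->
  b i1 q * riemann h i1 i1 i2 i2 q + b i2 q * riemann h i2 i1 i2 i2 q =
  (pd i1 (c i2) q - pd i2 (c i1) q) * a i2 q.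
Proof.
  intro Hq.
  assert (P1 := pd_christoffel_b i1 i2 i2 q Hq).
  assert (P2 := pd_christoffel_b i2 i1 i2 q Hq).
  assert (S := b_schwarz q Hq).
  assert (A : forall i j, pd i (a j) q =
    a i1 q * christoffel h i1 i j q + a i2 q * christoffel h i2 i j q + c i q * b j q).
  { intros i j. rewrite christoffel_a by assumption. unfold nabla_a. ring. }
  assert (B : forall i j, pd i (b j) q =
    b i1 q * christoffel h i1 i j q + b i2 q * christoffel h i2 i j q - c i q * a j q).
  { intros i j. rewrite christoffel_b by assumption. unfold nabla_b. ring. }
  rewrite !A, !B in P1, P2.
  unfold riemann, sum_idx.
  lra.
Qed.

Lemma gauss_curvature_coframe q : V q ->
  gauss_curvature h q = - (pd i1 (c i2) q - pd i2 (c i1) q) / coframe_det q.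
Proof.
  intro Hq. unfold gauss_curvature, sum_idx.
  rewrite metric_det_coframe, !metric_coframe by assumption.
  (* Expands the inner product of R(d_1, d_2) d_2 with d_1 in the orthonormal coframe, so that only
     its two coframe components enter. *)
  replace (_ + _) with
    (a i1 q * (a i1 q * riemann h i1 i1 i2 i2 q + a i2 q * riemann h i2 i1 i2 i2 q)
     + b i1 q * (b i1 q * riemann h i1 i1 i2 i2 q + b i2 q * riemann h i2 i1 i2 i2 q)) by ring.
  rewrite riemann_a, riemann_b by assumption.
  assert (D0 := det_neq q Hq). unfold coframe_det in *. field. exact D0.
Qed.

End Coframe.

(** * Smooth functions on the plane and symmetry of mixed derivatives *)

Lemma smooth_ex_pd V f i (l : list idx) q : smooth_on V f -> V q ->
  ex_pd i (fold_right pd f l) q.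
Proof.
  intros H Hq.
  replace (fold_right pd f l) with (iter_deriv (map basis l) f).
  - apply (H (map basis l) q Hq).
  - induction l as [|j l IH]; [reflexivity|]. simpl. rewrite IH. reflexivity.
Qed.

(** Links derivatives at parameter 0 along a line, as in [dir_deriv], with ordinary one-variable
    derivatives. *)
Lemma Derive_shift (g : R -> R) x : Derive (fun t => g (x + t)) 0 = Derive g x.
Proof.
  unfold Derive. f_equal. apply Lim_ext. intro t. rewrite Rplus_0_r, Rplus_0_l. reflexivity.
Qed.

Lemma ex_derive_shift (g : R -> R) x : ex_derive (fun t => g (x + t)) 0 -> ex_derive g x.
Proof.
  intro H. apply ex_derive_ext with (fun z => (fun t => g (x + t)) (z - x)).
  - intro t. simpl. f_equal. ring.
  - apply (ex_derive_comp (fun t => g (x + t)) (fun z => z - x)).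
    + replace (x - x) with 0 by ring. exact H.
    + auto_derive. auto.
Qed.

Lemma shift_plane (x y a b t : R) :
  plus ((x, y) : plane) (scal t ((a, b) : plane)) = (x + t * a, y + t * b).
Proof. reflexivity. Qed.

Lemma shift_J1 (x u v a b c t : R) :
  plus ((x, u, v) : J1) (scal t ((a, b, c) : J1)) = (x + t * a, u + t * b, v + t * c).
Proof. reflexivity. Qed.

Lemma shift_i1 x y t : plus ((x, y) : plane) (scal t (basis i1)) = (x + t, y).
Proof. simpl basis. rewrite shift_plane. apply (f_equal2 (@pair R R)); ring. Qed.

Lemma shift_i2 x y t : plus ((x, y) : plane) (scal t (basis i2)) = (x, y + t).
Proof. simpl basis. rewrite shift_plane. apply (f_equal2 (@pair R R)); ring. Qed.

Lemma pd_i1 f x y : pd i1 f (x, y) = Derive (fun z => f (z, y)) x.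
Proof.
  rewrite <- (Derive_shift (fun z => f (z, y))). apply Derive_ext.
  intro t. f_equal. apply shift_i1.
Qed.

Lemma pd_i2 f x y : pd i2 f (x, y) = Derive (fun z => f (x, z)) y.
Proof.
  rewrite <- (Derive_shift (fun z => f (x, z))). apply Derive_ext.
  intro t. f_equal. apply shift_i2.
Qed.

Lemma ex_pd_i1 f x y : ex_pd i1 f (x, y) -> ex_derive (fun z => f (z, y)) x.
Proof.
  intro H. apply ex_derive_shift. revert H. apply ex_derive_ext.
  intro t. f_equal. apply shift_i1.
Qed.

Lemma ex_pd_i2 f x y : ex_pd i2 f (x, y) -> ex_derive (fun z => f (x, z)) y.
Proof.
  intro H. apply ex_derive_shift. revert H. apply ex_derive_ext.
  intro t. f_equal. apply shift_i2.
Qed.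

Lemma smooth_pd V f i : smooth_on V f -> smooth_on V (pd i f).
Proof.
  intros H l q Hq.
  assert (E : iter_deriv l (pd i f) = iter_deriv (l ++ basis i :: nil) f).
  { clear. induction l as [|v l IH]; [reflexivity|]. simpl. now rewrite IH. }
  rewrite E. apply H, Hq.
Qed.

Lemma smooth_schwarz V f q : open V -> smooth_on V f -> V q ->
  pd i1 (pd i2 f) q = pd i2 (pd i1 f) q.
Proof.
  intros HV Hf Hq. destruct q as [x y].
  assert (E12 : forall u v, pd i1 (pd i2 f) (u, v) =
    Derive (fun z => Derive (fun t => f (z, t)) v) u).
  { intros. rewrite pd_i1. apply Derive_ext. intro. apply pd_i2. }
  assert (E21 : forall u v, pd i2 (pd i1 f) (u, v) =
    Derive (fun z => Derive (fun t => f (t, z)) u) v).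
  { intros. rewrite pd_i2. apply Derive_ext. intro. apply pd_i1. }
  rewrite E12, E21. apply (Schwarz (fun u v => f (u, v))).
  - apply locally_2d_locally. generalize (HV _ Hq). apply filter_imp.
    intros [u v] Huv. simpl. repeat split.
    + apply ex_pd_i1, (smooth_ex_pd V f i1 nil); auto.
    + apply ex_pd_i2, (smooth_ex_pd V f i2 nil); auto.
    + apply ex_derive_ext with (fun z => pd i2 f (z, v)); [intro; apply pd_i2|].
      apply ex_pd_i1, (smooth_ex_pd V f i1 (i2 :: nil)); auto.
    + apply ex_derive_ext with (fun z => pd i1 f (u, z)); [intro; apply pd_i1|].
      apply ex_pd_i2, (smooth_ex_pd V f i2 (i1 :: nil)); auto.
  - apply continuity_2d_pt_filterlim. rewrite <- E12.
    apply filterlim_ext with (pd i1 (pd i2 f)).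
    + intros [u v]. apply E12.
    + apply (Hf (basis i1 :: basis i2 :: nil) (x, y) Hq).
  - apply continuity_2d_pt_filterlim. rewrite <- E21.
    apply filterlim_ext with (pd i2 (pd i1 f)).
    + intros [u v]. apply E21.
    + apply (Hf (basis i2 :: basis i1 :: nil) (x, y) Hq).
Qed.

(** * The chain rule for an autonomous function on the jet space *)

Definition d_u : J1 := (0, 1, 0).
Definition d_u1 : J1 := (0, 0, 1).

Lemma shift_u x u v t : plus ((x, u, v) : J1) (scal t d_u) = (x, u + t, v).
Proof.
  unfold d_u. rewrite shift_J1.
  apply (f_equal2 (@pair plane R)); [apply (f_equal2 (@pair R R))|]; ring.
Qed.

Lemma shift_u1 x u v t : plus ((x, u, v) : J1) (scal t d_u1) = (x, u, v + t).
Proof.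
  unfold d_u1. rewrite shift_J1.
  apply (f_equal2 (@pair plane R)); [apply (f_equal2 (@pair R R))|]; ring.
Qed.

Lemma continuous_pair {A B C : UniformSpace} (f : A -> B) (g : A -> C) (t : A) :
  continuous f t -> continuous g t -> continuous (fun s => (f s, g s)) t.
Proof.
  intros Hf Hg. apply (continuous_comp_2 f g pair t Hf Hg).
  apply continuous_ext with (fun w => w); [now intros [? ?]|apply continuous_id].
Qed.

(** Autonomy removes the x-term of the chain rule, so continuity is all that is asked of [gx]. *)
Lemma is_derive_autonomous (U : J1 -> Prop) (phi : J1 -> R) (gx gu gv : R -> R)
    (dgu dgv t0 : R) :
  open U -> smooth_on U phi -> depends_on_u_u1 U phi -> U (gx t0, gu t0, gv t0) ->
  continuous gx t0 -> is_derive gu t0 dgu -> is_derive gv t0 dgv ->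
  is_derive (fun t => phi (gx t, gu t, gv t)) t0
    (dir_deriv d_u phi (gx t0, gu t0, gv t0) * dgu
     + dir_deriv d_u1 phi (gx t0, gu t0, gv t0) * dgv).
Proof.
  intros HU Hphi Hdep Hp Cx Du Dv.
  set (x0 := gx t0).
  assert (Cu : continuous gu t0) by (apply @ex_derive_continuous; eexists; exact Du).
  assert (Cv : continuous gv t0) by (apply @ex_derive_continuous; eexists; exact Dv).
  assert (slice : continuous (fun w : plane => (x0, fst w, snd w) : J1) (gu t0, gv t0)).
  { apply (continuous_pair (fun w : plane => (x0, fst w) : plane) (fun w : plane => snd w)).
    - apply (continuous_pair (fun w : plane => x0) (fun w : plane => fst w)).
      + apply continuous_const.
      + apply continuous_fst.
    - apply continuous_snd. }
  apply is_derive_ext_loc with (fun t => phi (x0, gu t, gv t)).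
  (* Autonomy lets the x-coordinate be frozen at [x0], which reduces to two variables. *)
  - assert (L1 : locally t0 (fun t => U (x0, gu t, gv t))).
    { assert (K : continuous (fun t => (x0, gu t, gv t)) t0).
      { apply (continuous_pair (fun t => (x0, gu t)) gv); [|exact Cv].
        apply (continuous_pair (fun t => x0) gu); [apply continuous_const|exact Cu]. }
      apply (K U), HU, Hp. }
    assert (L2 : locally t0 (fun t => U (gx t, gu t, gv t))).
    { assert (K : continuous (fun t => (gx t, gu t, gv t)) t0).
      { apply (continuous_pair (fun t => (gx t, gu t)) gv); [|exact Cv].
        apply (continuous_pair gx gu); assumption. }
      apply (K U), HU, Hp. }
    generalize (filter_and _ _ L1 L2). apply filter_imp.
    intros t [H1 H2]. apply Hdep; auto.
  - set (f := fun u v : R => phi (x0, u, v)).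
    apply is_derive_Reals.
    apply (derivable_pt_lim_comp_2d f gu gv); try (apply is_derive_Reals; assumption).
    apply filterdiff_differentiable_pt_lim.
    (* Total differentiability in (u, u_1) follows from a u-derivative that exists nearby and is
       continuous at the point, together with the u_1-derivative at the point. *)
    apply (is_derive_filterdiff f (gu t0) (gv t0)
      (fun u v => dir_deriv d_u phi (x0, u, v)) (dir_deriv d_u1 phi (x0, gu t0, gv t0))).
    + assert (L : locally (gu t0, gv t0) (fun w : plane => U (x0, fst w, snd w)))
        by apply (slice U), HU, Hp.
      revert L. apply filter_imp. intros [u v] Huv. simpl in *.
      replace (dir_deriv d_u phi (x0, u, v)) with (Derive (fun z => f z v) u).
      * apply Derive_correct, ex_derive_shift.
        generalize (proj2 (Hphi nil _ Huv) d_u). apply ex_derive_ext.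
        intro t. simpl. unfold f. now rewrite <- shift_u.
      * rewrite <- (Derive_shift (fun z => f z v)). apply Derive_ext.
        intro t. unfold f. now rewrite <- shift_u.
    + replace (dir_deriv d_u1 phi (x0, gu t0, gv t0))
        with (Derive (fun z => f (gu t0) z) (gv t0)).
      * apply Derive_correct, ex_derive_shift.
        generalize (proj2 (Hphi nil _ Hp) d_u1). apply ex_derive_ext.
        intro t. simpl. unfold f. now rewrite <- shift_u1.
      * rewrite <- (Derive_shift (fun z => f (gu t0) z)). apply Derive_ext.
        intro t. unfold f. now rewrite <- shift_u1.
    + apply (continuous_comp (fun w : plane => (x0, fst w, snd w) : J1) (dir_deriv d_u phi));
        [exact slice|].
      apply (Hphi (d_u :: nil) _ Hp).
Qed.

(** Linearity of [dir_deriv] in the direction is not built in; here it comes from the chain rule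
    along the straight line with velocity e_1(p). *)
Lemma lie_deriv_e1 (U : J1 -> Prop) (phi : J1 -> R) (p : J1) :
  open U -> smooth_on U phi -> depends_on_u_u1 U phi -> U p ->
  lie_deriv (e1 phi) phi p = dir_deriv d_u phi p * cu1 p + dir_deriv d_u1 phi p * phi p.
Proof.
  intros HU Hphi Hdep Hp. destruct p as [[x u] v].
  unfold lie_deriv, dir_deriv at 1, e1. cbn [cu1 snd].
  set (f := phi (x, u, v)).
  apply is_derive_unique.
  apply is_derive_ext with (fun t => phi (x + t, u + t * v, v + t * f)).
  { intro t. f_equal. rewrite shift_J1.
    apply (f_equal2 (@pair plane R)); [apply (f_equal2 (@pair R R))|]; ring. }
  (* Writes the base point as the value of the line at 0, the form in which the chain rule states
     it. *)
  assert (E0 : (x + 0, u + 0 * v, v + 0 * f) = (x, u, v)) by (f_equal; [f_equal|]; ring).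
  rewrite <- E0.
  apply (is_derive_autonomous U phi (fun t => x + t) (fun t => u + t * v) (fun t => v + t * f));
    auto.
  - rewrite E0. exact Hp.
  - apply @ex_derive_continuous. auto_derive. auto.
  - auto_derive; [auto|ring].
  - auto_derive; [auto|ring].
Qed.

(** * Curvature of a parametrized integral surface of ker omega^3 *)

Section Leaf.

Variables (U : J1 -> Prop) (phi : J1 -> R).
Hypothesis U_open : open U.
Hypothesis phi_smooth : smooth_on U phi.
Hypothesis phi_autonomous : depends_on_u_u1 U phi.

Variables (V : plane -> Prop) (x u v : plane -> R).
Hypothesis V_open : open V.
Hypothesis x_smooth : smooth_on V x.
Hypothesis u_smooth : smooth_on V u.
Hypothesis v_smooth : smooth_on V v.
Hypothesis in_U : forall q, V q -> U (x q, u q, v q).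
Hypothesis v_neq : forall q, V q -> v q <> 0.

(** The coefficient F in dv = F du. *)
Definition slope (q : plane) : R := phi (x q, u q, v q) / v q.

(** The two conditions say that omega^3 vanishes on the surface and that dx /\ du does not. *)
Hypothesis tangent_v : forall i q, V q -> pd i v q = slope q * pd i u q.
Hypothesis immersed : forall q, V q -> pd i1 x q * pd i2 u q - pd i2 x q * pd i1 u q <> 0.

(** The coefficient in d(phi) = [slope_factor] du along the surface; it equals e_1(phi) / u_1. *)
Definition slope_factor (q : plane) : R :=
  dir_deriv d_u phi (x q, u q, v q) + dir_deriv d_u1 phi (x q, u q, v q) * slope q.

Lemma has_pd_phi i q : V q ->
  has_pd i (fun r => phi (x r, u r, v r)) q (slope_factor q * pd i u q).
Proof.
  intro Hq.
  assert (H := is_derive_autonomous U phi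
    (fun t => x (plus q (scal t (basis i)))) (fun t => u (plus q (scal t (basis i))))
    (fun t => v (plus q (scal t (basis i)))) (pd i u q) (pd i v q) 0 U_open phi_smooth
    phi_autonomous).
  cbv beta in H. rewrite !(base_point i) in H.
  eapply has_pd_eq; [apply H|].
  - auto.
  - apply @ex_derive_continuous, (smooth_ex_pd V x i nil q); assumption.
  - apply ex_pd_correct, (smooth_ex_pd V u i nil q); assumption.
  - apply ex_pd_correct, (smooth_ex_pd V v i nil q); assumption.
  - rewrite tangent_v by assumption. unfold slope_factor. ring.
Qed.

Lemma has_pd_smooth f i q : smooth_on V f -> V q -> has_pd i f q (pd i f q).
Proof. intros. now apply ex_pd_correct, (smooth_ex_pd V f i nil q). Qed.

(** Quotient rule for F = phi / v, simplified by phi = F v and dv = F du. *)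
Lemma has_pd_slope i q : V q ->
  has_pd i slope q ((slope_factor q - slope q ^ 2) / v q * pd i u q).
Proof.
  intro Hq. assert (v0 := v_neq q Hq).
  eapply has_pd_eq.
  - apply has_pd_div; [apply has_pd_phi, Hq|apply has_pd_smooth; eauto|exact v0].
  - rewrite tangent_v by assumption. unfold slope. field. exact v0.
Qed.

(** The components of beta, the restriction of omega^2. *)
Definition contact (i : idx) (q : plane) : R := pd i u q - v q * pd i x q.

Lemma has_pd_contact i j q : V q ->
  has_pd i (contact j) q (pd i (pd j u) q - (pd i v q * pd j x q + v q * pd i (pd j x) q)).
Proof.
  intro Hq. apply has_pd_minus; [|apply has_pd_mult]; apply has_pd_smooth; auto using smooth_pd.
Qed.

Lemma has_pd2_contact i j k q : V q ->
  has_pd i (pd j (contact k)) q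
    (pd i (pd j (pd k u)) q
     - (pd i (pd j v) q * pd k x q + pd j v q * pd i (pd k x) q
        + (pd i v q * pd j (pd k x) q + v q * pd i (pd j (pd k x)) q))).
Proof.
  intro Hq.
  apply has_pd_ext with V
    (fun r => pd j (pd k u) r - (pd j v r * pd k x r + v r * pd j (pd k x) r)); auto.
  - intros r Hr. symmetry. apply pd_unique, has_pd_contact, Hr.
  - apply has_pd_minus; [|apply has_pd_plus; apply has_pd_mult];
      apply has_pd_smooth; auto using smooth_pd.
Qed.

(** With connection form F beta, dF /\ beta contributes ([slope_factor] - F^2) dx /\ du and F
    d(beta) contributes F^2 dx /\ du, so the squares cancel. *)
Lemma gauss_curvature_leaf (h : idx -> idx -> plane -> R) q :
  (forall i j r, V r -> h i j r = pd i x r * pd j x r + contact i r * contact j r) ->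
  V q -> gauss_curvature h q = - slope_factor q.
Proof.
  intros Hh Hq.
  assert (Sx : forall r, V r -> pd i1 (pd i2 x) r = pd i2 (pd i1 x) r)
    by (intros; eapply smooth_schwarz; eauto).
  assert (Su : forall r, V r -> pd i1 (pd i2 u) r = pd i2 (pd i1 u) r)
    by (intros; eapply smooth_schwarz; eauto).
  assert (Sv : forall r, V r -> pd i1 (pd i2 v) r = pd i2 (pd i1 v) r)
    by (intros; eapply smooth_schwarz; eauto).
  assert (Sx2 : forall r, V r -> pd i1 (pd i2 (pd i2 x)) r = pd i2 (pd i1 (pd i2 x)) r)
    by (intros; eapply smooth_schwarz; eauto using smooth_pd).
  assert (Su2 : forall r, V r -> pd i1 (pd i2 (pd i2 u)) r = pd i2 (pd i1 (pd i2 u)) r)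
    by (intros; eapply smooth_schwarz; eauto using smooth_pd).
  assert (Pb : forall i j r, V r -> pd i (contact j) r
     = pd i (pd j u) r - (pd i v r * pd j x r + v r * pd i (pd j x) r))
    by (intros; now apply pd_unique, has_pd_contact).
  assert (Pc : forall i j r, V r -> has_pd i (fun s => slope s * contact j s) r
     ((slope_factor r - slope r ^ 2) / v r * pd i u r * contact j r
      + slope r * pd i (contact j) r)).
  { intros i j r Hr. apply has_pd_mult; [now apply has_pd_slope|].
    eapply ex_pd_correct, has_pd_ex, has_pd_contact, Hr. }
  (* dx /\ beta = dx /\ du, since the dx-part of beta drops out. *)
  assert (Dd : forall r, V r -> coframe_det (fun i => pd i x) contact r
     = pd i1 x r * pd i2 u r - pd i2 x r * pd i1 u r)
    by (intros; unfold coframe_det, contact; ring).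
  rewrite (gauss_curvature_coframe V h (fun i => pd i x) contact
             (fun i r => slope r * contact i r)); auto.
  - rewrite Dd, (pd_unique _ _ _ _ (Pc i1 i2 q Hq)), (pd_unique _ _ _ _ (Pc i2 i1 q Hq)), !Pb
      by assumption.
    rewrite !tangent_v, Sx, Su by assumption. unfold contact.
    assert (v0 := v_neq q Hq). assert (D0 := immersed q Hq). field. auto.
  - intros r Hr. rewrite Dd by assumption. auto.
  - intros. eapply has_pd_ex, has_pd_smooth; auto using smooth_pd.
  - intros. eapply has_pd_ex, has_pd_contact; assumption.
  - intros. eapply has_pd_ex, Pc; assumption.
  - intros. eapply has_pd_ex, has_pd_smooth; auto using smooth_pd.
  - intros. eapply has_pd_ex, has_pd2_contact; assumption.
  (* Both sides vanish: d(dx) = 0 and F beta /\ beta = 0. *)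
  - intros r Hr. rewrite Sx by assumption. ring.
  (* d(beta) = - dv /\ dx = F dx /\ du, which is - F beta /\ dx. *)
  - intros r Hr. rewrite !Pb, !tangent_v, Sx, Su by assumption. unfold contact. ring.
  - intros r Hr. rewrite !(pd_unique _ _ _ _ (has_pd2_contact _ _ _ r Hr)).
    rewrite Sv, Sx2, Su2 by assumption. ring.
Qed.

End Leaf.

(** * From local parametrizations of a leaf to its curvature *)

Lemma tangent_comb_eq psi q s t :
  tangent_comb psi q s t =
  (s * pd i1 (fun r => cx (psi r)) q + t * pd i2 (fun r => cx (psi r)) q,
   s * pd i1 (fun r => cu (psi r)) q + t * pd i2 (fun r => cu (psi r)) q,
   s * pd i1 (fun r => cu1 (psi r)) q + t * pd i2 (fun r => cu1 (psi r)) q).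
Proof. reflexivity. Qed.

Lemma tangent_comb_zero psi q s t :
  s * pd i1 (fun r => cx (psi r)) q + t * pd i2 (fun r => cx (psi r)) q = 0 ->
  s * pd i1 (fun r => cu (psi r)) q + t * pd i2 (fun r => cu (psi r)) q = 0 ->
  s * pd i1 (fun r => cu1 (psi r)) q + t * pd i2 (fun r => cu1 (psi r)) q = 0 ->
  tangent_comb psi q s t = zero.
Proof. intros Hx Hu Hv. rewrite tangent_comb_eq, Hx, Hu, Hv. reflexivity. Qed.

Theorem corollary4p1 (U : J1 -> Prop) (phi : J1 -> R)
    (U_open : open U) (phi_smooth : smooth_on U phi)
    (phi_autonomous : depends_on_u_u1 U phi)
    (Sigma : J1 -> Prop) (Sigma_leaf : energy_leaf U phi Sigma)
    (p : J1) (p_in : Sigma p) :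
  has_gauss_curvature (ode_metric phi) Sigma p
    (- (lie_deriv (e1 phi) phi p / cu1 p)).
Proof.
  destruct Sigma_leaf as [[_ [Sigma_M [Sigma_reg [Sigma_tan _]]]] _].
  split; [exact (Sigma_reg p p_in)|].
  intros V psi q Hpar Hq Hpsi.
  destruct (Hpar) as [V_open [[sx [su sv]] [Himm [_ Hopen]]]].
  set (x := fun r => cx (psi r)). set (u := fun r => cu (psi r)).
  set (v := fun r => cu1 (psi r)).
  assert (Epsi : forall r, psi r = (x r, u r, v r)).
  { intro r. unfold x, u, v. now destruct (psi r) as [[? ?] ?]. }
  (* The last clause of [parametrization], taken with V' = V, contains the inclusion of the image in
     the leaf. *)
  assert (in_Sigma : forall r, V r -> Sigma (psi r)).
  { intros r Hr. destruct (Hopen V V_open (fun _ h => h)) as [W [_ HW]].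
    apply HW. now exists r. }
  assert (in_U : forall r, V r -> U (x r, u r, v r)).
  { intros r Hr. rewrite <- Epsi. apply Sigma_M; auto. }
  assert (v_neq : forall r, V r -> v r <> 0).
  { intros r Hr. apply (Sigma_M (psi r)); auto. }
  assert (tan : forall i r, V r -> pd i v r = slope phi x u v r * pd i u r).
  { intros i r Hr.
    (* These coefficients select the i-th coordinate vector, which is tangent to the leaf and hence
       annihilated by omega^3. *)
    set (s := match i with i1 => 1 | i2 => 0 end).
    set (t := match i with i1 => 0 | i2 => 1 end).
    assert (H : omega3 phi (psi r) (tangent_comb psi r s t) = 0).
    { apply Sigma_tan; [auto|]. now exists V, psi, r, s, t. }
    rewrite tangent_comb_eq in H. unfold omega3 in H.
    fold x u v in H. cbn [cu cu1 fst snd] in H.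
    rewrite Epsi in H. unfold slope. cbn [cu1 snd] in H.
    destruct i; unfold s, t in H; lra. }
  rewrite (lie_deriv_e1 U) by (auto; apply Sigma_M; auto).
  assert (v0 := v_neq q Hq).
  transitivity (- slope_factor phi x u v q).
  - apply (gauss_curvature_leaf U phi U_open phi_smooth phi_autonomous V x u v); auto.
    (* If dx /\ du vanished, then, as dv = F du, the combinations with coefficients (u_2, -u_1) and
       (x_2, -x_1), subscripts denoting partial derivatives, would be zero. The immersion property
       then gives u_1 = x_1 = 0, so the first coordinate vector is zero, a contradiction. *)
    + intros r Hr H0.
      assert (Z1 : tangent_comb psi r (pd i2 u r) (- pd i1 u r) = zero).
      { apply tangent_comb_zero; fold x u v; rewrite ?tan by assumption; lra. }
      assert (Z2 : tangent_comb psi r (pd i2 x r) (- pd i1 x r) = zero).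
      { apply tangent_comb_zero; fold x u v; [lra|lra|].
        rewrite !tan by assumption.
        transitivity (slope phi x u v r * - (pd i1 x r * pd i2 u r - pd i2 x r * pd i1 u r));
          [ring|rewrite H0; ring]. }
      apply Himm in Z1, Z2; auto.
      assert (u10 : pd i1 u r = 0) by lra. assert (x10 : pd i1 x r = 0) by lra.
      assert (Z3 : tangent_comb psi r 1 0 = zero).
      { apply tangent_comb_zero; fold x u v; rewrite ?tan, ?u10, ?x10 by assumption; ring. }
      apply Himm in Z3; auto. lra.
    (* g is the sum of the squares of omega^1, omega^2 and omega^3, and the last restricts to
       zero. *)
    + intros i j r Hr. unfold induced_metric, ode_metric, coord_vector.
      fold x u v. cbn [cx cu cu1 fst snd].
      fold (x r) (u r) (v r).
      rewrite !tan by assumption. rewrite (Epsi r). cbn [cx cu cu1 fst snd].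
      unfold contact, slope. assert (w0 := v_neq r Hr). field. exact w0.
  - rewrite <- Hpsi, (Epsi q). unfold slope_factor, slope. cbn [cu1 snd]. field. exact v0.
Qed.
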